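(* Let $G$ be the simple graph on the $157$ vertices $$a,\ b,\ c_i,\ d_{ij},\ e_{ij},\ p_{ij},\ q_{ij},\ r_{ij},\ s_{ij}\qquad (1\le i,j\le 5)$$ whose edge set consists exactly of the following $311$ edges: $(a,b)$; $(a,c_i)$ and $(b,c_i)$ for $1\le i\le 5$; $(a,d_{ij})$, $(c_i,d_{ij})$, $(b,e_{ij})$, $(c_i,e_{ij})$ for $1\le i,j\le 5$; and $(a,p_{ij})$, $(d_{ij},p_{ij})$, $(c_i,q_{ij})$, $(d_{ij},q_{ij})$, $(b,r_{ij})$, $(e_{ij},r_{ij})$, $(c_i,s_{ij})$, $(e_{ij},s_{ij})$ for $1\le i,j\le 5$. Then $\mathrm{box}(G)=3$.
   Context: Equivalently, $G$ is obtained from the single edge $(a,b)$ by repeated split operations: splitting an edge $(u,v)$ means adding a new vertex $w$ and new edges $(u,w)$, $(v,w)$ (keeping $(u,v)$). Concretely: split $(a,b)$ five times to get $c_1,\dots,c_5$; for each $i$, split $(a,c_i)$ five times to get $d_{i1},\dots,d_{i5}$ and split $(b,c_i)$ five times to get $e_{i1},\dots,e_{i5}$; for each $i,j$, split $(a,d_{ij})$, $(c_i,d_{ij})$, $(b,e_{ij})$, $(c_i,e_{ij})$ to get $p_{ij},q_{ij},r_{ij},s_{ij}$ respectively. In particular $G$ is a series-parallel graph (a $2$-tree). The boxicity $\mathrm{box}(G)$ of a graph $G$ is the minimum $d$ such that each vertex $v$ can be assigned a $d$-dimensional axis-parallel box $R_1\times\cdots\times R_d$ (each $R_i$ a closed real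 interval) so that two distinct vertices are adjacent if and only if their boxes intersect. *)

(* Defs.v *)
From HB Require Import structures.
From mathcomp Require Import all_boot all_order all_algebra.
From mathcomp Require Import boolp classical_sets set_interval reals.

Set Implicit Arguments.
Unset Strict Implicit.
Unset Printing Implicit Defensive.

Import Order.TTheory GRing.Theory Num.Theory.
Local Open Scope classical_set_scope.
Local Open Scope ring_scope.

Record sgraph := SGraph {
  svertex :> finType;
  sadj : rel svertex;
  sadj_sym : symmetric sadj;
  sadj_irrefl : irreflexive sadj
}.

Section Boxicity.
Variables (R : realType) (G : sgraph).

Definition box (d : nat) (l u : 'I_d -> R) : set ('I_d -> R) :=
  [set x | forall k, x k \in `[l k, u k]].

(* The condition [l v k <= u v k] makes all intervals nonempty.  For [d = 0]
   a box is the one-point space, so exactly the complete graphs have a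
   0-dimensional representation. *)
Definition has_box_representation (d : nat) : Prop :=
  exists l u : G -> 'I_d -> R,
    (forall v k, l v k <= u v k) /\
    (forall v w : G, v != w ->
       (sadj v w <-> box (l v) (u v) `&` box (l w) (u w) !=set0)).

(* One dimension per vertex [z], separating [z] from its non-neighbours. *)
Lemma has_box_representation_card : has_box_representation #|G|.
Proof.
exists (fun v k => if (v == enum_val k) || sadj (enum_val k) v then 0 else 1).
exists (fun v k => if v == enum_val k then 0 else 1).
split=> [v k|v w vw]; first by case: eqP => //=; case: ifP.
split=> [vw_adj|[x [xv xw]]].
  exists (fun k => if (v == enum_val k) || (w == enum_val k) then 0 else 1).
  split=> k /=; rewrite in_itv /=.
    case: (eqVneq v (enum_val k)) => [_|_] /=; first by rewrite lexx.
    case: (eqVneq w (enum_val k)) => [<-|_] /=.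
      by rewrite sadj_sym vw_adj lexx ler01.
    by case: ifP; rewrite ?lexx ?ler01.
  case: (eqVneq w (enum_val k)) => [_|_] /=; first by rewrite orbT lexx.
  case: (eqVneq v (enum_val k)) => [<-|_] /=.
    by rewrite vw_adj lexx ler01.
  by case: ifP; rewrite ?lexx ?ler01.
move: (xv (enum_rank v)) (xw (enum_rank v)) => /=.
rewrite enum_rankK eqxx eq_sym (negbTE vw) /= !in_itv /= => /andP[_ x0].
case: ifP => // _ /andP[x1 _].
by have := le_trans x1 x0; rewrite ler10.
Qed.

Lemma ex_box_representation : exists d, `[< has_box_representation d >].
Proof. by exists #|G|; apply/asboolP/has_box_representation_card. Qed.

Definition boxicity : nat := ex_minn ex_box_representation.

End Boxicity.

(* Indices range over ['I_5], i.e. 0..4 instead of 1..5. *)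
Inductive vertex :=
  | Va | Vb
  | Vc of 'I_5
  | Vd of 'I_5 & 'I_5 | Ve of 'I_5 & 'I_5
  | Vp of 'I_5 & 'I_5 | Vq of 'I_5 & 'I_5
  | Vr of 'I_5 & 'I_5 | Vs of 'I_5 & 'I_5.

Definition vertex_code (v : vertex) : bool + 'I_5 + 'I_6 * ('I_5 * 'I_5) :=
  match v with
  | Va => inl (inl false) | Vb => inl (inl true)
  | Vc i => inl (inr i)
  | Vd i j => inr (inord 0, (i, j)) | Ve i j => inr (inord 1, (i, j))
  | Vp i j => inr (inord 2, (i, j)) | Vq i j => inr (inord 3, (i, j))
  | Vr i j => inr (inord 4, (i, j)) | Vs i j => inr (inord 5, (i, j))
  end.

Definition vertex_decode (c : bool + 'I_5 + 'I_6 * ('I_5 * 'I_5)) : vertex :=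
  match c with
  | inl (inl b) => if b then Vb else Va
  | inl (inr i) => Vc i
  | inr (k, (i, j)) =>
      nth Va [:: Vd i j; Ve i j; Vp i j; Vq i j; Vr i j; Vs i j] k
  end.

Lemma vertex_codeK : cancel vertex_code vertex_decode.
Proof. by case=> //= i j; rewrite inordK. Qed.

HB.instance Definition _ := Finite.copy vertex (can_type vertex_codeK).

Definition edge (u v : vertex) : bool :=
  match u, v with
  | Va, Vb => true
  | Va, Vc _ | Vb, Vc _ => true
  | Va, Vd _ _ | Vb, Ve _ _ => true
  | Vc i, Vd i' _ | Vc i, Ve i' _ => i == i'
  | Va, Vp _ _ | Vb, Vr _ _ => true
  | Vc i, Vq i' _ | Vc i, Vs i' _ => i == i'
  | Vd i j, Vp i' j' | Vd i j, Vq i' j' => (i == i') && (j == j')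
  | Ve i j, Vr i' j' | Ve i j, Vs i' j' => (i == i') && (j == j')
  | _, _ => false
  end.

Definition adj (u v : vertex) : bool := edge u v || edge v u.

Lemma adj_sym : symmetric adj.
Proof. by move=> u v; rewrite /adj orbC. Qed.

Lemma adj_irrefl : irreflexive adj.
Proof. by case. Qed.

Definition G157 : sgraph := SGraph adj_sym adj_irrefl.

Lemma vertex_decodeK : cancel vertex_decode vertex_code.
Proof.
move=> [[[]|i]|[[k lt_k] [i j]]] //=; case: k lt_k => [|[|[|[|[|[|//]]]]]] lt_k /=;
  by congr (inr (_, _)); apply: val_inj; rewrite /= inordK.
Qed.

Lemma card_G157 : #|G157| = 157.
Proof.
rewrite (bij_eq_card (Bijective vertex_codeK vertex_decodeK)).
by rewrite !card_sum !card_prod card_bool !card_ord.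
Qed.

(* Main.v *)
Require Import Defs.
From mathcomp Require Import all_boot all_order all_algebra.
From mathcomp Require Import boolp classical_sets reals.
From mathcomp Require Import zify lra.

(** Lower bound.  Suppose [G] is drawn with rectangles, and let [w_1, ..., w_5]
be pairwise disjoint rectangles meeting both ends of an edge [(u, v)].  Some
[w_i] contains none of the four corners of the rectangle [u `&` v], so in one
direction it lies strictly inside [u `&` v].  If [w_i] has a neighbour meeting
[u] but not [v] and one meeting [v] but not [u], then in the other direction
[w_i] covers [u `&` v] and neither of [u], [v] contains the other.  Apply this
to the edge [(a, b)], which gives [c], and then to [(a, c)], which gives [d]:
both times the direction must be the same, and hence [d] meets [b],
a contradiction.

Upper bound.  Draw an edge [(u, v)] so that, in a private region, [u] is
[x <= X] and [v] is [y <= Y].  Each new [w] is a small box around the line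
[x = X], [y = Y], with its own range of [z].  Then the lines [x = X],
[y = Y + eps] and [x = X + eps], [y = Y] play the same role for the edges
[(u, w)] and [(v, w)], so that the splitting can be iterated. *)

Set Implicit Arguments.
Unset Strict Implicit.
Unset Printing Implicit Defensive.

Import Order.TTheory GRing.Theory Num.Theory.

Section BoxRepresentations.
Local Open Scope classical_set_scope.
Local Open Scope ring_scope.
Variables (R : realType) (G : sgraph).
Implicit Types (d : nat) (v w : G).

(** Nonempty boxes meet iff in every direction each begins no later than the other ends; stated so,
    adjacency is a matter of linear inequalities. *)
Definition box_repr d (l u : G -> 'I_d -> R) : Prop :=
  (forall v k, l v k <= u v k) /\
  (forall v w, v != w ->
     (sadj v w <-> forall k, l v k <= u w k /\ l w k <= u v k)).

Lemma box_meetP d (l1 u1 l2 u2 : 'I_d -> R) :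
  (forall k, l1 k <= u1 k) -> (forall k, l2 k <= u2 k) ->
  (box l1 u1 `&` box l2 u2 !=set0) <->
  (forall k, l1 k <= u2 k /\ l2 k <= u1 k).
Proof.
move=> le1 le2; split=> [[x [x1 x2]] k|meet12].
  move: (x1 k) (x2 k); rewrite !in_itv /= => /andP[? ?] /andP[? ?].
  by split; lra.
exists (fun k => Num.max (l1 k) (l2 k)); split=> k /=;
  have [? ?] := meet12 k; have ? := le1 k; have ? := le2 k;
  rewrite in_itv /= le_max ge_max lexx ?orbT /=; apply/andP; split; lra.
Qed.

Lemma has_box_reprP d :
  has_box_representation R G d <-> exists l u : G -> 'I_d -> R, box_repr l u.
Proof.
split=> -[l [u [le_lu adjP]]]; exists l, u; split=> // v w vw.
  by rewrite adjP // box_meetP.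
by rewrite adjP // box_meetP.
Qed.

Lemma has_box_representation_leq d d' :
  (d <= d')%N -> has_box_representation R G d -> has_box_representation R G d'.
Proof.
move=> le_dd' /has_box_reprP[l [u [le_lu adjP]]]; apply/has_box_reprP.
(* The added directions give every vertex the interval [[0, 0]], so they separate nothing. *)
pose ext (f : G -> 'I_d -> R) v (k : 'I_d') :=
  if insub (val k) is Some k' then f v k' else 0.
exists (ext l), (ext u); split=> [v k|v w vw]; first by rewrite /ext; case: insub.
rewrite adjP //; split=> [meet k|meet k]; first by rewrite /ext; case: insub.
by have := meet (widen_ord le_dd' k); rewrite /ext /= (valK k).
Qed.

Section FixedRepresentation.
Variables (d : nat) (l u : G -> 'I_d -> R).
Hypothesis lu : box_repr l u.

Lemma box_repr_le v k : l v k <= u v k.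
Proof. by case: lu. Qed.

Lemma box_repr_adj v w k : sadj v w -> l v k <= u w k /\ l w k <= u v k.
Proof.
move=> vw; have nvw : v != w by apply: contraTneq vw => ->; rewrite sadj_irrefl.
by case: lu => _ /(_ _ _ nvw)[/(_ vw)].
Qed.

(* Each member of the family not satisfying the conclusion contains one of the
   [2 ^ d] corners of the box of common points of [x] and [y]. *)
Lemma box_repr_inside (I : finType) (x y : G) (w : I -> G) :
  (2 ^ d < #|I|)%N -> injective w -> sadj x y ->
  (forall i, sadj x (w i)) -> (forall i, sadj y (w i)) ->
  (forall i j, ~~ sadj (w i) (w j)) ->
  exists i k, Num.max (l x k) (l y k) < l (w i) k /\
              u (w i) k < Num.min (u x k) (u y k).
Proof.
move=> ltI injw xy xw yw ww.
case: (boolP [exists i, exists k, (Num.max (l x k) (l y k) < l (w i) k) &&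
              (u (w i) k < Num.min (u x k) (u y k))]) => [|noin].
  by move=> /existsP[i /existsP[k /andP[? ?]]]; exists i, k.
(* [f i] names a corner in [w i]: the lower end where true, the upper end where false. Two members
   with the same corner would meet. *)
pose f i : {ffun 'I_d -> bool} := [ffun k => l (w i) k <= Num.max (l x k) (l y k)].
have /injectivePn[i [j nij fij]] : ~~ injectiveb f.
  apply/negP => /injectiveP/leq_card; rewrite card_ffun card_bool card_ord.
  by rewrite leqNgt ltI.
have : sadj (w i) (w j); last by rewrite (negbTE (ww i j)).
case: (lu) => _ adjP; apply/adjP; first by rewrite (inj_eq injw).
move=> k; have /ffunP/(_ k) := fij; rewrite !ffunE.
have corner m : l (w m) k <= Num.max (l x k) (l y k) \/
                Num.min (u x k) (u y k) <= u (w m) k.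
  move: noin => /existsPn/(_ m)/existsPn/(_ k).
  by rewrite negb_and -!leNgt => /orP.
have := corner i; have := corner j => {corner}.
have [? ?] := box_repr_adj k (xw i); have [? ?] := box_repr_adj k (yw i).
have [? ?] := box_repr_adj k (xw j); have [? ?] := box_repr_adj k (yw j).
have [? ?] := box_repr_adj k xy.
rewrite !le_max !ge_min; case: (lerP (l (w i) k) (l x k)) => ?;
  case: (lerP (l (w i) k) (l y k)) => ?;
  case: (lerP (l (w j) k) (l x k)) => ?;
  case: (lerP (l (w j) k) (l y k)) => ? //= + +;
  try by (move=> _ _ _; lra).
by move=> [|/orP[]?] // [|/orP[]?] // _; lra.
Qed.

End FixedRepresentation.

Lemma ord2_rev (k k' : 'I_2) : k' = k \/ k' = rev_ord k.
Proof.
by case: k k' => [[|[|//]] ?] [[|[|//]] ?]; [left|right|right|left]; exact: val_inj.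
Qed.

Lemma box_repr_crossing (l u : G -> 'I_2 -> R) (I : finType) (x y : G) (w : I -> G) :
  box_repr l u -> (4 < #|I|)%N -> injective w -> sadj x y ->
  (forall i, sadj x (w i)) -> (forall i, sadj y (w i)) ->
  (forall i j, ~~ sadj (w i) (w j)) ->
  (forall i, exists p, [/\ sadj p x, sadj p (w i), p != y & ~~ sadj p y]) ->
  (forall i, exists q, [/\ sadj q y, sadj q (w i), q != x & ~~ sadj q x]) ->
  exists i k, let k' := rev_ord k in
    [/\ Num.max (l x k) (l y k) < l (w i) k,
        u (w i) k < Num.min (u x k) (u y k),
        l (w i) k' <= Num.max (l x k') (l y k'),
        Num.min (u x k') (u y k') <= u (w i) k' &
        ~ (l x k' <= l y k' /\ u y k' <= u x k')].
Proof.
move=> lu I4 injw xy xw yw ww pE qE.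
have [i [k [maxw wmin]]] := box_repr_inside lu I4 injw xy xw yw ww.
exists i, k => k'; have [_ adjP] := lu.
(* In direction [k], [p] meets [w i], which lies inside [z]; so only [k'] can separate [p] from
   [z]. *)
have sep z p : l z k < l (w i) k -> u (w i) k < u z k ->
    sadj p (w i) -> p != z -> ~~ sadj p z -> u p k' < l z k' \/ u z k' < l p k'.
  move=> lz uz pw pz npz.
  case: (ltrP (u p k') (l z k')) => [|zp]; first by left.
  case: (ltrP (u z k') (l p k')) => [|pz']; first by right.
  case/negP: npz; apply/adjP => // m.
  have [->|->] := ord2_rev k m; last by [].
  by have [? ?] := box_repr_adj lu k pw; split; lra.
have [lx ly] : l x k < l (w i) k /\ l y k < l (w i) k.
  by move: maxw; rewrite gt_max => /andP[].
have [ux uy] : u (w i) k < u x k /\ u (w i) k < u y k.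
  by move: wmin; rewrite lt_min => /andP[].
have [p [px pw py npy]] := pE i; have [q [qy qw qx nqx]] := qE i.
have {py npy ly uy} py := sep y p ly uy pw py npy.
have {sep qx nqx lx ux} qx := sep x q lx ux qw qx nqx.
have [? ?] := box_repr_adj lu k' px; have [? ?] := box_repr_adj lu k' pw.
have [? ?] := box_repr_adj lu k' qy; have [? ?] := box_repr_adj lu k' qw.
(* In direction [k'], [p] and [q] lie beyond opposite ends of the common part of [x] and [y], and
   [w i] reaches both. Since [q] meets [y] but misses [x], [y] is not within [x]. *)
split=> //; rewrite ?le_max ?ge_min.
- by apply/orP; case: qx py => ? [] ?; [exfalso|left|right|exfalso]; lra.
- by apply/orP; case: qx py => ? [] ?; [exfalso|right|left|exfalso]; lra.
- by move=> [? ?]; case: qx py => ? [] ?; lra.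
Qed.

End BoxRepresentations.

Section G157.
Variable R : realType.
Local Open Scope ring_scope.

Lemma G157_not_box2 : ~ has_box_representation R G157 2.
Proof.
move=> /has_box_reprP[l [u lu]].
have ord5 : (4 < #|'I_5|)%N by rewrite card_ord.
have [|||||i|i|i [k [maxc cmin _ _ _]]] :=
  @box_repr_crossing R G157 l u 'I_5 Va Vb Vc lu ord5; try by [].
- by move=> ? ? [].
- by exists (Vd i ord0); split; rewrite //= /adj /= ?eqxx ?orbT.
- by exists (Ve i ord0); split; rewrite //= /adj /= ?eqxx ?orbT.
have [||j|j|j j'|j|j|j [m [maxd dmin ld ud nest]]] :=
  @box_repr_crossing R G157 l u 'I_5 Va (Vc i) (Vd i) lu ord5; try by [].
- by move=> ? ? [].
- by rewrite /= /adj /= eqxx.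
- by exists (Vp i j); split; rewrite //= /adj /= ?eqxx ?orbT.
- by exists (Vq i j); split; rewrite //= /adj /= ?eqxx ?orbT.
move: maxc cmin maxd dmin ld ud nest; rewrite !gt_max !lt_min !le_max !ge_min.
move=> /andP[? ?] /andP[? ?] /andP[? ?] /andP[? ?] ld ud nest.
(* Were the directions different, [nest] would deny that [Vc i] lies within [Va] in direction
   [k]. *)
have [km|mk] := ord2_rev k m; last by case: nest; rewrite mk rev_ordK; split; lra.
subst m; suff : sadj (Vd i j : G157) Vb by [].
case: (lu) => _ adjP; apply/adjP => // n.
(* In direction [k], [Vd i j] is inside [Vc i], which is inside [Vb]. In the other it covers the
   common part of [Va] and [Vc i], which meets [Vb] because the three intervals meet pairwise. *)
have [->|->] := ord2_rev k n; first by have ? := box_repr_le lu (Vd i j) k; split; lra.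
have [? ?] := @box_repr_adj _ _ _ _ _ lu Va Vb (rev_ord k) isT.
have [? ?] := @box_repr_adj _ _ _ _ _ lu (Vc i) Vb (rev_ord k) isT.
by case/orP: ld => ?; case/orP: ud => ?; split; lra.
Qed.

(* The initial line is [x = 10], [y = 10], and [eps] is 9, 3, 1 at the three
   levels of splitting. *)
Definition coord_lo (v : vertex) (k : 'I_3) : nat :=
  nth 0%N match v return seq nat with
  | Va => [:: 0; 0; 0] | Vb => [:: 0; 0; 0]
  | Vc i => [:: 1; 1; 5 * i]
  | Vd i j => [:: 7; 16; 5 * i + j] | Ve i j => [:: 16; 7; 5 * i + j]
  | Vp i j => [:: 9; 21; 5 * i + j] | Vr i j => [:: 21; 9; 5 * i + j]
  | Vq i j => [:: 12; 18; 5 * i + j] | Vs i j => [:: 18; 12; 5 * i + j]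
  end%N k.

(** The boxes of c, d, p, q are centred at [(10, 10)], [(10, 19)], [(10, 22)], [(13, 19)]; e, r, s
    mirror d, p, q. In the third direction [Vc i] spans the block of all [5 * i + j]. *)
Definition coord_hi (v : vertex) (k : 'I_3) : nat :=
  nth 0%N match v return seq nat with
  | Va => [:: 10; 30; 24] | Vb => [:: 30; 10; 24]
  | Vc i => [:: 19; 19; 5 * i + 4]
  | Vd i j => [:: 13; 22; 5 * i + j] | Ve i j => [:: 22; 13; 5 * i + j]
  | Vp i j => [:: 11; 23; 5 * i + j] | Vr i j => [:: 23; 11; 5 * i + j]
  | Vq i j => [:: 14; 20; 5 * i + j] | Vs i j => [:: 20; 14; 5 * i + j]
  end%N k.

Lemma forall_ord3 (P : 'I_3 -> Prop) :
  (forall k, P k) <-> [/\ P (inord 0), P (inord 1) & P (inord 2)].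
Proof.
split=> [//|[P0 P1 P2] k].
have [||] : [\/ k = inord 0, k = inord 1 | k = inord 2]; try by move=> ->.
by case: k => [[|[|[|//]]] ?]; [constructor 1|constructor 2|constructor 3];
  apply: val_inj; rewrite /= inordK.
Qed.

Lemma coord_adjP (v w : vertex) : v != w ->
  adj v w <-> forall k, (coord_lo v k <= coord_hi w k)%N /\
                        (coord_lo w k <= coord_hi v k)%N.
Proof.
move=> /eqP vw; rewrite forall_ord3 /coord_lo /coord_hi !inordK //.
case: v vw => [||[i ?]|[i ?] [j ?]|[i ?] [j ?]|[i ?] [j ?]
               |[i ?] [j ?]|[i ?] [j ?]|[i ?] [j ?]];
  case: w => [||[i' ?]|[i' ?] [j' ?]|[i' ?] [j' ?]|[i' ?] [j' ?]
             |[i' ?] [j' ?]|[i' ?] [j' ?]|[i' ?] [j' ?]] vw;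
  rewrite /adj /= ?orbF ?orbT -?val_eqE /=;
  try (by split=> //; case; lia);
  try (by split=> [?|[_ _ [? ?]]]; [split; split; lia | lia]);
  (* For two vertices of the same kind only the third direction can separate; as [j < 5],
     [5 * i + j] determines both indices. *)
  by split=> // -[_ _ [? ?]]; case: vw; f_equal; apply: val_inj => /=; lia.
Qed.

Lemma G157_box3 : has_box_representation R G157 3.
Proof.
apply/has_box_reprP.
exists (fun v k => (coord_lo v k)%:R), (fun v k => (coord_hi v k)%:R); split.
  move=> v k; rewrite ler_nat; move: k; apply/forall_ord3.
  rewrite /coord_lo /coord_hi !inordK //.
  by case: v => *; split=> /=; lia.
move=> v w vw /=; rewrite coord_adjP //.
by split=> meet k; have := meet k; rewrite !ler_nat.
Qed.

End G157.

Theorem theorem4 (R : realType) : boxicity R G157 = 3.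
Proof.
rewrite /boxicity; case: ex_minnP => d /asboolP dP dmin.
apply/eqP; rewrite eqn_leq dmin; last exact/asboolP/G157_box3.
rewrite ltnNge; apply/negP => d2.
exact: G157_not_box2 (has_box_representation_leq d2 dP).
Qed.
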